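(* Let $(A,\circ)$ be a Novikov algebra, $(M,\cdot,l_A,r_A)$ an $A$-bimodule Novikov algebra, $\lambda\in\mathbf k$, and let $\alpha:M\to A$ be an $\mathcal O$-operator of weight $\lambda$ on $(A,\circ)$ associated to $(M,\cdot,l_A,r_A)$. Then: (i) $M$ with the three operations $x\circ_M y:=\lambda\, x\cdot y$, $x\rhd y:=l_A(\alpha(x))y$, $x\lhd y:=r_A(\alpha(y))x$ ($x,y\in M$) is a post-Novikov algebra $(M,\circ_M,\lhd,\rhd)$. (ii) $\alpha$ is a Novikov algebra homomorphism from $(M,\circledcirc)$ to $(A,\circ)$, where $x\circledcirc y:=x\rhd y+x\lhd y+x\circ_M y$. (iii) If $\mathrm{Ker}(\alpha)$ is an ideal of $(M,\cdot)$, then there is an induced (well-defined) post-Novikov algebra structure on $\alpha(M)$ given by $$\alpha(x)\circ_\alpha\alpha(y):=\lambda\,\alpha(x\cdot y),\quad \alpha(x)\rhd_\alpha\alpha(y):=\alpha(l_A(\alpha(x))y),\quad \alpha(x)\lhd_\alpha\alpha(y):=\alpha(r_A(\alpha(y))x),\qquad x,y\in M.$$ Furthermore, $\alpha$ is a homomorphism of post-Novikov algebras from $(M,\circ_M,\lhd,\rhd)$ to $(\alpha(M),\circ_\alpha,\lhd_\alpha,\rhd_\alpha)$.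
   Context: $\mathbf k$ is a field of characteristic zero; all vector spaces are finite-dimensional over $\mathbf k$. A Novikov algebra $(A,\circ)$ is a vector space with a bilinear operation satisfying $(a\circ b)\circ c-a\circ(b\circ c)=(b\circ a)\circ c-b\circ(a\circ c)$ and $(a\circ b)\circ c=(a\circ c)\circ b$ for all $a,b,c\in A$. A bimodule of a Novikov algebra $(A,\circ)$ is a triple $(V,l_A,r_A)$ with $V$ a vector space and $l_A,r_A:A\to\mathrm{End}_{\mathbf k}(V)$ linear such that for all $a,b\in A$, $v\in V$: $l_A(a\circ b-b\circ a)v=l_A(a)l_A(b)v-l_A(b)l_A(a)v$; $l_A(a)r_A(b)v-r_A(b)l_A(a)v=r_A(a\circ b)v-r_A(b)r_A(a)v$; $l_A(a\circ b)v=r_A(b)l_A(a)v$; $r_A(a)r_A(b)v=r_A(b)r_A(a)v$. An $A$-bimodule Novikov algebra is a quadruple $(M,\cdot,l_A,r_A)$ where $(M,\cdot)$ is a Novikov algebra, $(M,l_A,r_A)$ is a bimodule of $(A,\circ)$, and for all $a\in A$, $v,w\in M$: $(l_A(a)v)\cdot w-l_A(a)(v\cdot w)=(r_A(a)v)\cdot w-v\cdot(l_A(a)w)$; $r_A(a)(v\cdot w)-v\cdot(r_A(a)w)=r_A(a)(w\cdot v)-w\cdot(r_A(a)v)$; $(l_A(a)v)\cdot w=(l_A(a)w)\cdot v$; $r_A(a)(v\cdot w)=(r_A(a)v)\cdot w$. An $\mathcal O$-operator of weight $\lambda$ on $(A,\circ)$ associated to $(M,\cdot,l_A,r_A)$ is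 a linear map $\alpha:M\to A$ with $\alpha(u)\circ\alpha(v)=\alpha\big(l_A(\alpha(u))v+r_A(\alpha(v))u+\lambda\,u\cdot v\big)$ for all $u,v\in M$. A post-Novikov algebra is a quadruple $(A,\circ,\lhd,\rhd)$ where $(A,\circ)$ is a Novikov algebra and $\lhd,\rhd$ are bilinear operations such that for all $a,b,c\in A$: (1) $(a\rhd c)\lhd b=(a\rhd b+a\lhd b+a\circ b)\rhd c$; (2) $a\rhd(c\lhd b)-(a\rhd c)\lhd b+(c\lhd a)\lhd b=c\lhd(a\lhd b+a\rhd b+a\circ b)$; (3) $(a\rhd b+a\lhd b+a\circ b)\rhd c-(b\rhd a+b\lhd a+b\circ a)\rhd c=a\rhd(b\rhd c)-b\rhd(a\rhd c)$; (4) $(a\lhd b)\lhd c=(a\lhd c)\lhd b$; (5) $(a\rhd b)\circ c-a\rhd(b\circ c)=(b\lhd a)\circ c-b\circ(a\rhd c)$; (6) $(b\circ c)\lhd a-b\circ(c\lhd a)=(c\circ b)\lhd a-c\circ(b\lhd a)$; (7) $(a\rhd b)\circ c=(a\rhd c)\circ b$; (8) $(a\circ b)\lhd c=(a\lhd c)\circ b$. A homomorphism of post-Novikov algebras is a linear map preserving all three operations. For a post-Novikov algebra, $a\circledcirc b=a\rhd b+a\lhd b+a\circ b$ defines a Novikov algebra. *)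

(* Defs.v *)
From HB Require Import structures.
From mathcomp Require Import all_boot all_order all_algebra.
Set Implicit Arguments. Unset Strict Implicit. Unset Printing Implicit Defensive.
Import GRing.Theory.
Local Open Scope ring_scope.

(* Binary operations are plain functions; their bilinearity is
   part of the algebra structures below. *)

Definition bilinear_op (K : fieldType) (V : vectType K) (op : V -> V -> V) : Prop :=
  (forall v, linear (fun u => op u v)) /\ (forall u, linear (fun v => op u v)).

Record is_novikov (K : fieldType) (A : vectType K) (op : A -> A -> A) : Prop := {
  novikov_bilinear : bilinear_op op;
  novikov_left_sym : forall a b c,
    op (op a b) c - op a (op b c) = op (op b a) c - op b (op a c);
  novikov_right_comm : forall a b c, op (op a b) c = op (op a c) b
}.

Record is_bimodule (K : fieldType) (A : vectType K) (circ : A -> A -> A)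
    (V : vectType K) (lA rA : {linear A -> 'End(V)}) : Prop := {
  bimodule_l_comm : forall a b v,
    lA (circ a b - circ b a) v = lA a (lA b v) - lA b (lA a v);
  bimodule_l_r : forall a b v,
    lA a (rA b v) - rA b (lA a v) = rA (circ a b) v - rA b (rA a v);
  bimodule_l_circ : forall a b v, lA (circ a b) v = rA b (lA a v);
  bimodule_r_comm : forall a b v, rA a (rA b v) = rA b (rA a v)
}.

Record is_bimodule_novikov (K : fieldType) (A : vectType K) (circ : A -> A -> A)
    (M : vectType K) (dot : M -> M -> M) (lA rA : {linear A -> 'End(M)}) : Prop := {
  bimodnov_novikov : is_novikov dot;
  bimodnov_bimodule : is_bimodule circ lA rA;
  bimodnov_l_r : forall a v w,
    dot (lA a v) w - lA a (dot v w) = dot (rA a v) w - dot v (lA a w);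
  bimodnov_r_sym : forall a v w,
    rA a (dot v w) - dot v (rA a w) = rA a (dot w v) - dot w (rA a v);
  bimodnov_l_comm : forall a v w, dot (lA a v) w = dot (lA a w) v;
  bimodnov_r_dot : forall a v w, rA a (dot v w) = dot (rA a v) w
}.

Definition is_O_operator (K : fieldType) (lambda : K)
    (A : vectType K) (circ : A -> A -> A)
    (M : vectType K) (dot : M -> M -> M) (lA rA : {linear A -> 'End(M)})
    (alpha : 'Hom(M, A)) : Prop :=
  forall u v, circ (alpha u) (alpha v) =
    alpha (lA (alpha u) v + rA (alpha v) u + lambda *: dot u v).

Definition circledcirc (K : fieldType) (A : vectType K)
    (circ lhd rhd : A -> A -> A) (a b : A) : A :=
  rhd a b + lhd a b + circ a b.

(* Argument order: circ, lhd, rhd. *)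
Record is_post_novikov (K : fieldType) (A : vectType K)
    (circ lhd rhd : A -> A -> A) : Prop := {
  post_novikov_circ : is_novikov circ;
  post_novikov_lhd_bilinear : bilinear_op lhd;
  post_novikov_rhd_bilinear : bilinear_op rhd;
  post_novikov1 : forall a b c,
    lhd (rhd a c) b = rhd (rhd a b + lhd a b + circ a b) c;
  post_novikov2 : forall a b c,
    rhd a (lhd c b) - lhd (rhd a c) b + lhd (lhd c a) b =
    lhd c (lhd a b + rhd a b + circ a b);
  post_novikov3 : forall a b c,
    rhd (rhd a b + lhd a b + circ a b) c - rhd (rhd b a + lhd b a + circ b a) c =
    rhd a (rhd b c) - rhd b (rhd a c);
  post_novikov4 : forall a b c, lhd (lhd a b) c = lhd (lhd a c) b;
  post_novikov5 : forall a b c,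
    circ (rhd a b) c - rhd a (circ b c) = circ (lhd b a) c - circ b (rhd a c);
  post_novikov6 : forall a b c,
    lhd (circ b c) a - circ b (lhd c a) = lhd (circ c b) a - circ c (lhd b a);
  post_novikov7 : forall a b c, circ (rhd a b) c = circ (rhd a c) b;
  post_novikov8 : forall a b c, lhd (circ a b) c = circ (lhd a c) b
}.

Definition is_algebra_hom (K : fieldType) (A B : vectType K)
    (opA : A -> A -> A) (opB : B -> B -> B) (f : A -> B) : Prop :=
  linear f /\ (forall x y, f (opA x y) = opB (f x) (f y)).

Definition is_post_novikov_hom (K : fieldType) (A B : vectType K)
    (circA lhdA rhdA : A -> A -> A) (circB lhdB rhdB : B -> B -> B)
    (f : A -> B) : Prop :=
  linear f /\
  forall x y, [/\ f (circA x y) = circB (f x) (f y),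
                  f (lhdA x y) = lhdB (f x) (f y) &
                  f (rhdA x y) = rhdB (f x) (f y)].

Definition is_ideal (K : fieldType) (A : vectType K) (op : A -> A -> A)
    (I : {vspace A}) : Prop :=
  forall x i, i \in I -> op x i \in I /\ op i x \in I.

(* The linear map f with its codomain restricted to its image. *)
Definition corestr (K : fieldType) (U V : vectType K) (f : 'Hom(U, V)) (x : U) :
    subvs_of (limg f) :=
  Subvs (memv_img f (memvf x)).

(* Main.v *)
Require Import Defs.
From HB Require Import structures.
From mathcomp Require Import all_boot all_order all_algebra.
From mathcomp Require Import ring.
Set Implicit Arguments. Unset Strict Implicit. Unset Printing Implicit Defensive.
Import GRing.Theory.
Local Open Scope ring_scope.

(** The O-operator identity says exactly that [alpha] maps [circledcirc] on M
    to the product of A, so the post-Novikov axioms on M are the bimodule axioms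
    evaluated along [alpha].  If [u] is in the kernel, the identity for [(x, u)]
    and [(u, y)] shows that [l(alpha x) u] and [r(alpha y) u] are, up to sign,
    sent by [alpha] to [lambda alpha(x . u)] and [lambda alpha(u . y)]; these
    vanish when the kernel is an ideal, so all three operations descend along
    the surjection of M onto its image. *)

Section Bilinear.
Variables (K : fieldType) (V : vectType K) (op : V -> V -> V).
Hypothesis op_bilinear : bilinear_op op.

Lemma bilinear_opDl x y z : op (x + y) z = op x z + op y z.
Proof. by case: op_bilinear => + _ => /(_ z 1 x y); rewrite !scale1r. Qed.

Lemma bilinear_opDr x y z : op z (x + y) = op z x + op z y.
Proof. by case: op_bilinear => _ /(_ z 1 x y); rewrite !scale1r. Qed.

Lemma bilinear_op0l z : op 0 z = 0.
Proof. by apply: (addrI (op 0 z)); rewrite -bilinear_opDl !addr0. Qed.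

Lemma bilinear_op0r z : op z 0 = 0.
Proof. by apply: (addrI (op z 0)); rewrite -bilinear_opDr !addr0. Qed.

Lemma bilinear_opZl k x z : op (k *: x) z = k *: op x z.
Proof.
by case: op_bilinear => + _ => /(_ z k x 0); rewrite !addr0 bilinear_op0l addr0.
Qed.

Lemma bilinear_opZr k x z : op z (k *: x) = k *: op z x.
Proof.
by case: op_bilinear => _ /(_ z k x 0); rewrite !addr0 bilinear_op0r addr0.
Qed.

Lemma bilinear_opBl x y z : op (x - y) z = op x z - op y z.
Proof. by rewrite -scaleN1r bilinear_opDl bilinear_opZl scaleN1r. Qed.

Lemma bilinear_opBr x y z : op z (x - y) = op z x - op z y.
Proof. by rewrite -scaleN1r bilinear_opDr bilinear_opZr scaleN1r. Qed.

End Bilinear.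

Lemma bilinear_opD (K : fieldType) (V : vectType K) (op1 op2 : V -> V -> V) :
  bilinear_op op1 -> bilinear_op op2 ->
  bilinear_op (fun x y => op1 x y + op2 x y).
Proof.
by move=> [l1 r1] [l2 r2]; split=> z k x y; rewrite ?l1 ?l2 ?r1 ?r2 scalerDr addrACA.
Qed.

Lemma bilinear_opZ (K : fieldType) (V : vectType K) (op : V -> V -> V) (k : K) :
  bilinear_op op -> bilinear_op (fun x y => k *: op x y).
Proof.
by case=> l r; split=> z c x y; rewrite ?l ?r scalerDr !scalerA (mulrC k).
Qed.

Lemma is_novikov_scale (K : fieldType) (V : vectType K) (op : V -> V -> V) (k : K) :
  is_novikov op -> is_novikov (fun x y => k *: op x y).
Proof.
move=> nov; have bil := novikov_bilinear nov.
split=> [|a b c|a b c]; first exact: bilinear_opZ.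
- by rewrite !(bilinear_opZl bil) !(bilinear_opZr bil) -!scalerBr (novikov_left_sym nov).
- by rewrite !(bilinear_opZl bil) (novikov_right_comm nov).
Qed.

(* [ring] needs a commutative ring, so identities between sums of vectors are
   transported to K by an additive map. *)
Lemma eq_additive (K : fieldType) (V : vectType K) (x y : V) :
  (forall f : V -> K, {morph f : u v / u + v} -> {morph f : u / - u} -> f x = f y) ->
  x = y.
Proof.
move=> fxy; rewrite (coord_vbasis (memvf x)) (coord_vbasis (memvf y)).
apply: eq_bigr => i _; congr (_ *: _).
by apply: fxy => [u v|u]; [exact: linearD | exact: linearN].
Qed.

(** For left symmetry, the axioms with differences become replacement rules for one term; after
    expansion by bilinearity everything cancels. For right commutativity, [post_novikov1] supplies
    the terms that the expansion of [lhd] leaves unmatched on the other side. *)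
Lemma post_novikov_circledcirc (K : fieldType) (A : vectType K)
    (circ lhd rhd : A -> A -> A) :
  is_post_novikov circ lhd rhd -> is_novikov (circledcirc circ lhd rhd).
Proof.
case=> nov bl br p1 p2 p3 p4 p5 p6 p7 p8; have bc := novikov_bilinear nov.
rewrite /circledcirc; split=> [|a b c|a b c].
- by do 2?apply: bilinear_opD.
- have E3 := canRL (subrK _) (p3 a b c).
  have E5ab := canRL (subrK _) (p5 a b c).
  have E5ba := canRL (subrK _) (p5 b a c).
  have E6 := canRL (subrK _) (p6 c a b).
  have EN := canRL (subrK _) (novikov_left_sym nov a b c).
  (* The outer [rhd] terms are handled whole by [E3]. The sums inside are commuted so that they
     match the right side of [post_novikov2], which removes [lhd a (b * c)] and its mirror image,
     with [*] the total product. *)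
  rewrite E3 [rhd b c + lhd b c]addrC [rhd a c + lhd a c]addrC -!p2.
  rewrite !(bilinear_opDl bl) !(bilinear_opDl bc) !(bilinear_opDr br).
  rewrite !(bilinear_opDr bc) E5ab E5ba E6 EN.
  by apply: eq_additive => f fD fN; rewrite !(fD, fN); ring.
- rewrite -!p1.
  rewrite !(bilinear_opDl bl) !(bilinear_opDl bc) p4 p7 !p8 (novikov_right_comm nov).
  by apply: eq_additive => f fD fN; rewrite !(fD, fN); ring.
Qed.

(** The axioms are identities, so they pass to a homomorphic image: lift the arguments along [f],
    pull [f] out of both sides, and use the identity in [A]. *)
Lemma post_novikov_surj (K : fieldType) (A B : vectType K)
    (circA lhdA rhdA : A -> A -> A) (circB lhdB rhdB : B -> B -> B)
    (f : {linear A -> B}) :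
  (forall y, exists x, y = f x) ->
  is_post_novikov_hom circA lhdA rhdA circB lhdB rhdB f ->
  is_post_novikov circA lhdA rhdA -> is_post_novikov circB lhdB rhdB.
Proof.
move=> fsurj [_ hom] [nov bl br p1 p2 p3 p4 p5 p6 p7 p8].
have fc x y : circB (f x) (f y) = f (circA x y) by case: (hom x y).
have fl x y : lhdB (f x) (f y) = f (lhdA x y) by case: (hom x y).
have fr x y : rhdB (f x) (f y) = f (rhdA x y) by case: (hom x y).
have bil opA opB : (forall x y, opB (f x) (f y) = f (opA x y)) ->
    bilinear_op opA -> bilinear_op opB.
  move=> fop [opl opr].
  by split=> w k u v; have [x ->] := fsurj w; have [y ->] := fsurj u;
     have [z ->] := fsurj v; rewrite -linearP !fop ?opl ?opr linearP.
case: nov => bc ls rc; split; first split.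
all: try by apply: bil; eassumption.
all: move=> a b c; have [x ->] := fsurj a; have [y ->] := fsurj b;
     have [z ->] := fsurj c.
all: do ?rewrite ?(fc, fl, fr) -?(linearD, linearB).
all: by congr (f _).
Qed.

Section Corestriction.
Variables (K : fieldType) (U V : vectType K) (f : 'Hom(U, V)).

Lemma corestr_is_linear : linear (corestr f).
Proof. by move=> k x y; apply: val_inj; rewrite /= !linearP. Qed.

HB.instance Definition _ :=
  GRing.isLinear.Build K U (subvs_of (limg f)) _ (corestr f) corestr_is_linear.

Lemma corestr_surj (y : subvs_of (limg f)) : corestr f ((f^-1)%VF (vsval y)) = y.
Proof. by apply: val_inj; rewrite /= limg_lfunVK // subvsP. Qed.

(** The pseudo-inverse of [f] is a section over the image, so it picks representatives; this gives a
    total operation before independence of the choice is known. *)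
Definition induced_op (op : U -> U -> U) (x y : subvs_of (limg f)) :
    subvs_of (limg f) :=
  corestr f (op ((f^-1)%VF (vsval x)) ((f^-1)%VF (vsval y))).

(** The chosen representative of [f z] differs from [z] by a kernel element. Replacing one argument
    at a time, through [op x y'], changes the value only by terms that [f] kills. *)
Lemma induced_op_corestr (op : U -> U -> U) :
  bilinear_op op ->
  (forall x u, u \in lker f -> f (op x u) = 0 /\ f (op u x) = 0) ->
  forall x y, induced_op op (corestr f x) (corestr f y) = corestr f (op x y).
Proof.
move=> bop op_ker x y; apply: val_inj => /=.
have ker_section z : (f^-1)%VF (f z) - z \in lker f.
  by rewrite memv_ker linearB /= limg_lfunVK ?memv_img ?memvf // subrr.
have kx := ker_section x; have ky := ker_section y.
set x' := (f^-1)%VF (f x) in kx *; set y' := (f^-1)%VF (f y) in ky *.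
apply: (@etrans _ _ (f (op x y'))); apply/eqP; rewrite -subr_eq0 -linearB.
- by rewrite /= -(bilinear_opBl bop) (op_ker _ _ kx).2.
- by rewrite /= -(bilinear_opBr bop) (op_ker _ _ ky).1.
Qed.

End Corestriction.

Theorem theorem2p16 (K : fieldType) (char0 : [pchar K] =i pred0)
    (A : vectType K) (circ : A -> A -> A) (novA : is_novikov circ)
    (M : vectType K) (dot : M -> M -> M) (lA rA : {linear A -> 'End(M)})
    (bimodM : is_bimodule_novikov circ dot lA rA)
    (lambda : K) (alpha : 'Hom(M, A))
    (Oalpha : is_O_operator lambda circ dot lA rA alpha) :
  let circM (x y : M) : M := lambda *: dot x y in
  let rhdM (x y : M) : M := lA (alpha x) y in
  let lhdM (x y : M) : M := rA (alpha y) x in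
  [/\ is_post_novikov circM lhdM rhdM,
      is_novikov (circledcirc circM lhdM rhdM) /\
      is_algebra_hom (circledcirc circM lhdM rhdM) circ alpha &
      is_ideal dot (lker alpha) ->
      exists circa lhda rhda :
          subvs_of (limg alpha) -> subvs_of (limg alpha) -> subvs_of (limg alpha),
        [/\ forall x y : M,
              [/\ vsval (circa (corestr alpha x) (corestr alpha y)) =
                    lambda *: alpha (dot x y),
                  vsval (rhda (corestr alpha x) (corestr alpha y)) =
                    alpha (lA (alpha x) y) &
                  vsval (lhda (corestr alpha x) (corestr alpha y)) =
                    alpha (rA (alpha y) x)],
            is_post_novikov circa lhda rhda &
            is_post_novikov_hom circM lhdM rhdM circa lhda rhda (corestr alpha)]].
Proof.
move=> circM rhdM lhdM.
case: bimodM => nov [lC lr lcirc rC] dl dr dlC rdot.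
have bd := novikov_bilinear nov.
have alphaM x y : alpha (circledcirc circM lhdM rhdM x y) = circ (alpha x) (alpha y).
  by rewrite Oalpha.
have post : is_post_novikov circM lhdM rhdM.
  (* The sums inside the first three mixed axioms are total products, so [alpha] turns them into
     products in [A], where the bimodule axioms apply. *)
  have rhd_cc a b c : rhdM (rhdM a b + lhdM a b + circM a b) c =
      lA (circ (alpha a) (alpha b)) c by rewrite -alphaM.
  have lhd_cc a b c : lhdM c (lhdM a b + rhdM a b + circM a b) =
      rA (circ (alpha a) (alpha b)) c by rewrite -alphaM [lhdM a b + _]addrC.
  split.
  - exact: is_novikov_scale.
  - by split=> z k x y; rewrite /lhdM !linearP // add_lfunE scale_lfunE.
  - by split=> z k x y; rewrite /rhdM !linearP // add_lfunE scale_lfunE.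
  - by move=> a b c; rewrite rhd_cc lcirc.
  - by move=> a b c; rewrite lhd_cc /rhdM /lhdM lr subrK.
  - by move=> a b c; rewrite !rhd_cc -lC linearB add_lfunE opp_lfunE.
  - by move=> a b c; rewrite /lhdM rC.
  - by move=> a b c; rewrite /circM /rhdM /lhdM linearZ /= -!scalerBr dl.
  - by move=> a b c; rewrite /circM /lhdM !linearZ /= -!scalerDr dr.
  - by move=> a b c; rewrite /circM /rhdM dlC.
  - by move=> a b c; rewrite /circM /lhdM linearZ /= rdot.
have [_ bl br _ _ _ _ _ _ _ _] := post.
have bc : bilinear_op circM by apply: bilinear_opZ.
split=> //; first by split; [exact: post_novikov_circledcirc | split=> // ? ? ?; exact: linearP].
move=> idK.
have ker_circ x u : u \in lker alpha -> alpha (circM x u) = 0 /\ alpha (circM u x) = 0.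
  move=> /(idK x); rewrite !memv_ker => -[/eqP xu0 /eqP ux0].
  by rewrite /circM !linearZ /= xu0 ux0 scaler0.
have bcirc := novikov_bilinear novA.
have ker_rhd x u : u \in lker alpha -> alpha (rhdM x u) = 0 /\ alpha (rhdM u x) = 0.
  move=> ku; have /eqP au : alpha u == 0 by rewrite -memv_ker.
  (* With [u] on the left the acting operator is [lA 0 = 0]; only [u] on the right needs the ideal
     hypothesis. For [lhdM] the sides are exchanged. *)
  split; last by rewrite /rhdM au linear0 lfunE linear0.
  have := alphaM x u; rewrite /circledcirc !linearD /= (ker_circ x u ku).1 addr0.
  by rewrite [lhdM x u]/lhdM au linear0 lfunE linear0 addr0 (bilinear_op0r bcirc).
have ker_lhd x u : u \in lker alpha -> alpha (lhdM x u) = 0 /\ alpha (lhdM u x) = 0.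
  move=> ku; have /eqP au : alpha u == 0 by rewrite -memv_ker.
  split; first by rewrite /lhdM au linear0 lfunE linear0.
  have := alphaM u x; rewrite /circledcirc !linearD /= (ker_circ x u ku).2 addr0.
  by rewrite [rhdM u x]/rhdM au linear0 lfunE linear0 add0r (bilinear_op0l bcirc).
have ic := induced_op_corestr bc ker_circ.
have il := induced_op_corestr bl ker_lhd.
have ir := induced_op_corestr br ker_rhd.
have hom : is_post_novikov_hom circM lhdM rhdM (induced_op circM)
    (induced_op lhdM) (induced_op rhdM) (corestr alpha).
  by split=> [|x y]; [exact: corestr_is_linear | rewrite ic il ir].
exists (induced_op circM), (induced_op lhdM), (induced_op rhdM); split=> //.
- by move=> x y; rewrite ic il ir /= linearZ.
- apply: (post_novikov_surj _ hom post) => y.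
  by exists ((alpha^-1)%VF (vsval y)); exact/esym/corestr_surj.
Qed.
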